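(* Let $(\Omega,\Sigma,\mu)$ be an arbitrary measure space, set $X=L_1(\mu;\mathbb R)$, and let $D\subset B_X$ be a non-empty convex subset of the closed unit ball $B_X$. Let $\tau$ be a topology on $D$ containing the relative weak topology of $D$. (i) $D$ has the $\tau$-diameter two property if and only if it has the $\tau$-strong diameter two property. (ii) $D$ has the $\tau$-CPCP if and only if it is $\tau$-strongly regular. (iii) If there exists $0<\delta\leq 2$ such that every non-empty $\tau$-open subset of $D$ has diameter at least $\delta$, then $D$ is not $\tau$-strongly regular for open subsets.
   Context: For a non-empty bounded subset $C$ of a Banach space, $\operatorname{diam}(C)=\sup\{\|x-y\|:x,y\in C\}$. The relative weak topology on $D\subset X$ is the topology induced on $D$ by the weak topology of $X$. A finite convex combination of sets $U_1,\dots,U_n$ is a set $\sum_{i=1}^n\lambda_iU_i=\{\sum_{i=1}^n\lambda_iu_i:u_i\in U_i\}$ with $\lambda_i\ge 0$, $\sum_{i=1}^n\lambda_i=1$. Let $D$ be a non-empty bounded convex subset of a Banach space and $\tau$ a topology on $D$ containing its relative weak topology. For $C\subset D$, $\tau_C$ denotes the topology induced by $\tau$ on $C$. - $D$ has the $\tau$-diameter two property if every non-empty $\tau$-open subset of $D$ has diameter two. - $D$ has the $\tau$-strong diameter two property if every finite convex combination of non-empty $\tau$-open subsets of $D$ has diameter two. - $D$ has the $\tau$-convex point of continuity property ($\tau$-CPCP) if every non-empty bounded convex subset $C\subset D$ contains non-empty $\tau_C$-open subsets of arbitrarily small diameter. - $D$ is $\tau$-strongly regular if every non-empty bounded convex subset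 $C\subset D$ contains finite convex combinations of non-empty $\tau_C$-open subsets (of $C$) having arbitrarily small diameter. - $D$ is $\tau$-strongly regular for open subsets if every non-empty convex $\tau$-open subset $O\subset D$ contains finite convex combinations of non-empty $\tau_O$-open subsets (of $O$) having arbitrarily small diameter. *)

(* Defs.v *)
From HB Require Import structures.
From mathcomp Require Import all_boot all_order all_algebra.
From mathcomp Require Import boolp classical_sets functions reals.
From mathcomp Require Import interval_inference ereal topology convex normedtype.
From mathcomp Require Import sequences measure ess_sup_inf measurable_realfun.
From mathcomp Require Import lebesgue_measure lebesgue_integral numfun exp hoelder.

Set Implicit Arguments.
Unset Strict Implicit.
Unset Printing Implicit Defensive.
Import Order.TTheory GRing.Theory Num.Theory.
Import numFieldNormedType.Exports.
Local Open Scope classical_set_scope.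
Local Open Scope ring_scope.
Local Open Scope quotient_scope.

(* The library's [LspaceType mu p1] (functions with finite p-norm modulo
   equality mu-a.e.) carries no algebraic or normed structure; we equip it with
   its normed module structure: the operations are computed on representatives
   and the norm is the Lp-norm. *)
Section LspaceNormedModule.
Context {d : measure_display} {T : measurableType d} {R : realType}.
Context {mu : {measure set T -> \bar R}} {p : \bar R} {p1 : (1 <= p)%E}.

Local Notation L := (LspaceType mu p1).
Local Notation F := (LfunType mu p1).

Lemma ae_eq_Lnorm (f g : T -> R) : measurable_fun setT f -> measurable_fun setT g ->
  f = g %[ae mu] -> 'N[mu]_p[EFin \o f]%E = 'N[mu]_p[EFin \o g]%E.
Proof.
move=> mf mg fg; rewrite unlock; case: p p1 => [r _|_|]; last by [].
- have mpow (h : T -> R) : measurable_fun setT h ->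
      measurable_fun setT (fun x => `|(EFin \o h) x| `^ r)%E.
    move=> mh; apply/measurable_EFinP.
    apply: (@measurableT_comp _ _ _ _ _ _ (@powR R ^~ r)) => //.
    exact: measurableT_comp.
  congr (_ `^ _)%E; apply: ae_eq_integral => //; [exact: mpow|exact: mpow|].
  by apply: filterS fg => x /= /(_ I) -> _.
- case: ifPn => // mu0; apply: eq_ess_sup.
  by apply: filterS fg => x /= /(_ I) ->.
Qed.

Lemma Lspace_Lfun (x : L) : (x : T -> R) \in Lfun mu p.
Proof.
rewrite inE; apply/andP; split; rewrite inE /=.
  exact: (measurable_funP (repr (x : {mfun_ mu, T >-> measurableTypeR R}))).
exact: (@Lebesgue_finite _ _ _ _ _ _ x).
Qed.

Definition Lspace_rep (x : L) : F := Lfun_Sub p1 (Lspace_Lfun x).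

Lemma mfun_of_subproof (f : F) :
  measurable_fun setT (f : T -> measurableTypeR R).
Proof. exact: (measurable_funP f). Qed.

Definition mfun_of (f : F) : {mfun T >-> measurableTypeR R} :=
  HB.pack (f : T -> measurableTypeR R)
    (isMeasurableFun.Build _ _ _ _ _ (mfun_of_subproof f)).

Lemma repr_pi_ae (f : {mfun T >-> measurableTypeR R}) :
  (repr (\pi_({mfun_ mu, T >-> measurableTypeR R}) f) : T -> R) = f %[ae mu].
Proof.
have : repr (\pi_({mfun_ mu, T >-> measurableTypeR R}) f) = f
         %[mod {mfun_ mu, T >-> measurableTypeR R}] by rewrite reprK.
by move/eqmodP => /asboolP.
Qed.

Lemma finite_norm_pi (f : F) : finite_norm mu p
  (repr (\pi_({mfun_ mu, T >-> measurableTypeR R}) (mfun_of f)) : T -> R).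
Proof.
rewrite /finite_norm.
have -> : 'N[mu]_p[EFin \o (repr (\pi_({mfun_ mu, T >-> measurableTypeR R})
    (mfun_of f)) : T -> R)]%E = 'N[mu]_p[EFin \o f]%E.
  apply: ae_eq_Lnorm; last exact: repr_pi_ae.
    exact: (measurable_funP (repr
      (\pi_({mfun_ mu, T >-> measurableTypeR R}) (mfun_of f)))).
  exact: (measurable_funP f).
exact: Lfunction_finite.
Qed.

Definition Lspace_pi (f : F) : L :=
  @LebesgueSpace.Pack _ _ _ mu p p1
    (\pi_({mfun_ mu, T >-> measurableTypeR R}) (mfun_of f))
    (LebesgueSpace.Class (isFinLebesgue.Build _ _ _ mu p p1 _ (finite_norm_pi f))).

Lemma Lspace_eqP (x y : L) : x = y <-> x = y %[ae mu].
Proof.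
split=> [->|]; first by apply: nearW.
case: x y => [x [[xf]]] [y [[yf]]] /= xy.
have exy : x = y by rewrite -[x]reprK -[y]reprK; apply/eqmodP/asboolP.
by case: _ / exy in yf xy *; congr LebesgueSpace.Pack; congr LebesgueSpace.Class;
  congr isFinLebesgue.Axioms_; exact: Prop_irrelevance.
Qed.

Lemma Lspace_piE (f : F) : Lspace_pi f = f %[ae mu].
Proof. exact: repr_pi_ae. Qed.

Definition Lspace_zero : L := Lspace_pi 0.
Definition Lspace_opp (x : L) : L := Lspace_pi (- Lspace_rep x).
Definition Lspace_add (x y : L) : L := Lspace_pi (Lspace_rep x + Lspace_rep y).
Definition Lspace_scale (a : R) (x : L) : L := Lspace_pi (a *: Lspace_rep x).
Definition Lspace_norm (x : L) : R := fine ('N[mu]_p[EFin \o x])%E.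

Lemma Lspace_zeroE : Lspace_zero = (fun=> 0) %[ae mu].
Proof. exact: Lspace_piE. Qed.

Lemma Lspace_oppE x : Lspace_opp x = (fun t => - x t) %[ae mu].
Proof. exact: Lspace_piE. Qed.

Lemma Lspace_addE x y : Lspace_add x y = (fun t => x t + y t) %[ae mu].
Proof. exact: Lspace_piE. Qed.

Lemma Lspace_scaleE a x : Lspace_scale a x = (fun t => a * x t) %[ae mu].
Proof. exact: Lspace_piE. Qed.

Lemma Lspace_addA : associative Lspace_add.
Proof.
move=> x y z; apply/Lspace_eqP; near=> t => _.
have -> : Lspace_add x (Lspace_add y z) t = x t + Lspace_add y z t.
  by near: t; apply: filterS (Lspace_addE x (Lspace_add y z)) => t; exact.
have -> : Lspace_add y z t = y t + z t.
  by near: t; apply: filterS (Lspace_addE y z) => t; exact.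
have -> : Lspace_add (Lspace_add x y) z t = Lspace_add x y t + z t.
  by near: t; apply: filterS (Lspace_addE (Lspace_add x y) z) => t; exact.
have -> : Lspace_add x y t = x t + y t.
  by near: t; apply: filterS (Lspace_addE x y) => t; exact.
exact: addrA.
Unshelve. all: end_near. Qed.

Lemma Lspace_addC : commutative Lspace_add.
Proof. by move=> x y; rewrite /Lspace_add addrC. Qed.

Lemma Lspace_add0 : left_id Lspace_zero Lspace_add.
Proof.
move=> x; apply/Lspace_eqP; near=> t => _.
have -> : Lspace_add Lspace_zero x t = Lspace_zero t + x t.
  by near: t; apply: filterS (Lspace_addE Lspace_zero x) => t; exact.
have -> : Lspace_zero t = 0.
  by near: t; apply: filterS Lspace_zeroE => t; exact.
exact: add0r.
Unshelve. all: end_near. Qed.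

Lemma Lspace_addN : left_inverse Lspace_zero Lspace_opp Lspace_add.
Proof.
move=> x; apply/Lspace_eqP; near=> t => _.
have -> : Lspace_add (Lspace_opp x) x t = Lspace_opp x t + x t.
  by near: t; apply: filterS (Lspace_addE (Lspace_opp x) x) => t; exact.
have -> : Lspace_opp x t = - x t.
  by near: t; apply: filterS (Lspace_oppE x) => t; exact.
have -> : Lspace_zero t = 0.
  by near: t; apply: filterS Lspace_zeroE => t; exact.
exact: addNr.
Unshelve. all: end_near. Qed.

HB.instance Definition _ := gen_eqMixin L.
HB.instance Definition _ := gen_choiceMixin L.
HB.instance Definition _ := GRing.isZmodule.Build L
  Lspace_addA Lspace_addC Lspace_add0 Lspace_addN.

Lemma Lspace_scaleA a b x :
  Lspace_scale a (Lspace_scale b x) = Lspace_scale (a * b) x.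
Proof.
apply/Lspace_eqP; near=> t => _.
have -> : Lspace_scale a (Lspace_scale b x) t = a * Lspace_scale b x t.
  by near: t; apply: filterS (Lspace_scaleE a (Lspace_scale b x)) => t; exact.
have -> : Lspace_scale b x t = b * x t.
  by near: t; apply: filterS (Lspace_scaleE b x) => t; exact.
have -> : Lspace_scale (a * b) x t = a * b * x t.
  by near: t; apply: filterS (Lspace_scaleE (a * b) x) => t; exact.
exact: mulrA.
Unshelve. all: end_near. Qed.

Lemma Lspace_scale1 : left_id 1 Lspace_scale.
Proof.
move=> x; apply/Lspace_eqP; apply: filterS (Lspace_scaleE 1 x) => t + _.
by move=> ->//; rewrite mul1r.
Qed.

Lemma Lspace_scaleDr : right_distributive Lspace_scale +%R.
Proof.
move=> a x y; apply/Lspace_eqP; near=> t => _.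
have -> : Lspace_scale a (x + y) t = a * Lspace_add x y t.
  by near: t; apply: filterS (Lspace_scaleE a (x + y)) => t; exact.
have -> : Lspace_add x y t = x t + y t.
  by near: t; apply: filterS (Lspace_addE x y) => t; exact.
have -> : (Lspace_scale a x + Lspace_scale a y) t =
    Lspace_scale a x t + Lspace_scale a y t.
  by near: t; apply: filterS
    (Lspace_addE (Lspace_scale a x) (Lspace_scale a y)) => t; exact.
have -> : Lspace_scale a x t = a * x t.
  by near: t; apply: filterS (Lspace_scaleE a x) => t; exact.
have -> : Lspace_scale a y t = a * y t.
  by near: t; apply: filterS (Lspace_scaleE a y) => t; exact.
exact: mulrDr.
Unshelve. all: end_near. Qed.

Lemma Lspace_scaleDl x : {morph Lspace_scale^~ x : a b / a + b}.
Proof.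
move=> a b; apply/Lspace_eqP; near=> t => _.
have -> : Lspace_scale (a + b) x t = (a + b) * x t.
  by near: t; apply: filterS (Lspace_scaleE (a + b) x) => t; exact.
have -> : (Lspace_scale a x + Lspace_scale b x) t =
    Lspace_scale a x t + Lspace_scale b x t.
  by near: t; apply: filterS
    (Lspace_addE (Lspace_scale a x) (Lspace_scale b x)) => t; exact.
have -> : Lspace_scale a x t = a * x t.
  by near: t; apply: filterS (Lspace_scaleE a x) => t; exact.
have -> : Lspace_scale b x t = b * x t.
  by near: t; apply: filterS (Lspace_scaleE b x) => t; exact.
exact: mulrDl.
Unshelve. all: end_near. Qed.

HB.instance Definition _ := GRing.Zmodule_isLmodule.Build R L
  Lspace_scaleA Lspace_scale1 Lspace_scaleDr Lspace_scaleDl.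

Lemma Lspace_norm_pi (f : F) :
  Lspace_norm (Lspace_pi f) = fine ('N[mu]_p[EFin \o f])%E.
Proof.
congr fine; apply: ae_eq_Lnorm; last exact: Lspace_piE.
  exact: (measurable_funP (Lspace_rep (Lspace_pi f))).
exact: (measurable_funP f).
Qed.

Lemma Lspace_ler_normD (x y : L) :
  Lspace_norm (x + y) <= Lspace_norm x + Lspace_norm y.
Proof.
by rewrite Lspace_norm_pi; exact: (ler_LnormD (Lspace_rep x) (Lspace_rep y)).
Qed.

Lemma Lspace_normrZ (a : R) (x : L) :
  Lspace_norm (a *: x) = `|a| * Lspace_norm x.
Proof.
rewrite Lspace_norm_pi.
apply: EFin_inj; rewrite finite_norm_fine EFinM.
by rewrite (finite_norm_fine (Lspace_rep x)); exact: LnormZ.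
Qed.

Lemma Lspace_normr0_eq0 (x : L) : Lspace_norm x = 0 -> x = 0.
Proof.
move=> x0; apply/Lspace_eqP.
have {}x0 : (x : T -> R) = (fun=> 0) %[ae mu].
  exact: (@fine_Lnormr_eq0 _ _ _ _ _ _ (Lspace_rep x)).
near=> t => _.
have -> : (0 : L) t = 0.
  by near: t; apply: filterS Lspace_zeroE => t; exact.
by near: t; apply: filterS x0 => t; exact.
Unshelve. all: end_near. Qed.

HB.instance Definition _ := Lmodule_isNormed.Build R L
  Lspace_ler_normD Lspace_normrZ Lspace_normr0_eq0.

End LspaceNormedModule.

Lemma LspaceType1_normE (d : measure_display) (T : measurableType d)
    (R : realType) (mu : {measure set T -> \bar R}) (x : LspaceType1 mu) :
  `|x| = fine (\int[mu]_t `|x t|%:E)%E.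
Proof. by rewrite /Num.norm /= /Lspace_norm Lnorm1. Qed.

Section WeakTopology.
Context {R : realType} (X : normedModType R).

Definition continuous_dual : Type :=
  {f : {scalar X} | continuous (f : X -> R)}.

Definition weak_topology : Type :=
  sup_topology (fun f : continuous_dual =>
    Topological.on (initial_topology (sval f : X -> R))).

HB.instance Definition _ := Topological.on weak_topology.

End WeakTopology.

Section DiameterProperties.
Context {R : realType} {X : normedModType R}.
Implicit Types C D O W : set X.

(* [sup] is only meaningful here for nonempty bounded [C]. *)
Definition diam C : R := sup [set `|x - y| | x in C & y in C].

Definition conv_comb n (lambda : 'I_n -> R) (U : 'I_n -> set X) : set X :=
  [set \sum_i lambda i *: u i | u in [set u : 'I_n -> X | forall i, U i (u i)]].

Definition conv_combs (F : set_system X) : set_system X :=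
  [set W | exists n (lambda : 'I_n -> R) (U : 'I_n -> set X),
    [/\ forall i, 0 <= lambda i, \sum_i lambda i = 1,
        forall i, F (U i) & W = conv_comb lambda U]].

(* A topology on [D : set X] is a topological structure on the type of elements
   of [D]; its open sets are transported to [X] along [val]. *)
Section TopologyOnSubset.
Context {D : set X} (tau : Topological D).

Definition contains_relative_weak : Prop :=
  forall U : set (weak_topology X), open U ->
    @open (Topological.Pack tau) [set x : D | U (\val x)].

(* The nonempty tau_C-open sets, for [C `<=` D]. *)
Definition nonempty_open_in C : set_system X :=
  [set W | W !=set0 /\
    exists2 V : set D, @open (Topological.Pack tau) V &
      W = [set \val x | x in V] `&` C].

Definition diameter_two_property : Prop :=
  forall W, nonempty_open_in D W -> diam W = 2.

Definition strong_diameter_two_property : Prop :=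
  forall W, conv_combs (nonempty_open_in D) W -> diam W = 2.

Definition convex_point_of_continuity_property : Prop :=
  forall C, C `<=` D -> C !=set0 -> bounded_set C -> convex_set C ->
    forall e, 0 < e -> exists2 W, nonempty_open_in C W & diam W < e.

Definition strongly_regular : Prop :=
  forall C, C `<=` D -> C !=set0 -> bounded_set C -> convex_set C ->
    forall e, 0 < e ->
      exists2 W, conv_combs (nonempty_open_in C) W & diam W < e.

Definition strongly_regular_for_open_subsets : Prop :=
  forall O, nonempty_open_in D O -> convex_set O ->
    forall e, 0 < e ->
      exists2 W, conv_combs (nonempty_open_in O) W & diam W < e.

End TopologyOnSubset.
End DiameterProperties.

(* Main.v *)
(* If every nonempty tau_C-open set has diameter at least delta, then so does
   every convex combination of such sets; all three claims follow.  Given g in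
   L1 and a nonempty tau_C-open set U, choose f in U almost maximizing the
   convex functional Phi = \int sqrt (g^2 + f^2) over U.  Its derivative
   f / sqrt (g^2 + f^2) at f lies in L_infinity and so defines a weakly
   continuous functional; on a weak neighbourhood W of f in U where that
   functional is almost constant, the Bregman divergence of Phi at f is small.
   This forces \int min(|g|, |y - f|) to be small for all y in W, i.e. y - f is
   almost disjoint from g.  Picking y, z in W at distance almost delta gives
   |g + lam (y - z)| ~ |g| + lam |y - z|, and one iterates over the sets of the
   convex combination. *)

Require Import Defs.
From HB Require Import structures.
From mathcomp Require Import all_boot all_order all_algebra.
From mathcomp Require Import boolp classical_sets functions reals.
From mathcomp Require Import interval_inference ereal topology convex normedtype.
From mathcomp Require Import sequences measure ess_sup_inf measurable_realfun.
From mathcomp Require Import lebesgue_measure lebesgue_integral numfun exp hoelder.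
From mathcomp Require Import ring lra.
From mathcomp Require realfun.

Set Implicit Arguments.
Unset Strict Implicit.
Unset Printing Implicit Defensive.
Import Order.TTheory GRing.Theory Num.Theory.
Import numFieldNormedType.Exports.
Local Open Scope classical_set_scope.
Local Open Scope ring_scope.

(** * Pointwise estimates for [hypot] and its Bregman divergence *)

Section Hypot.
Context {R : realType}.
Implicit Types g f y eta : R.

(** The integrand of Phi: strictly convex in [f] when [g] is nonzero, unlike [|f|], yet of linear
    growth, so it remains integrable on L1. *)
Definition hypot g f : R := Num.sqrt (g ^+ 2 + f ^+ 2).

Lemma hypot_ge0 g f : 0 <= hypot g f.
Proof. exact: sqrtr_ge0. Qed.

Lemma hypot_sqr g f : hypot g f ^+ 2 = g ^+ 2 + f ^+ 2.
Proof. by rewrite sqr_sqrtr // addr_ge0 ?sqr_ge0. Qed.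

Lemma norm_le_hypot g f : `|f| <= hypot g f.
Proof. by rewrite -sqrtr_sqr ler_wsqrtr// lerDr sqr_ge0. Qed.

Lemma hypot_le_normD g f : hypot g f <= `|g| + `|f|.
Proof.
rewrite -(ler_pXn2r (n := 2)) ?nnegrE ?hypot_ge0 ?addr_ge0//.
rewrite hypot_sqr -(real_normK (num_real g)) -(real_normK (num_real f)).
have := mulr_ge0 (normr_ge0 g) (normr_ge0 f); nra.
Qed.

(* At [f = g = 0] the division gives [0], a subgradient of [hypot 0 = normr]. *)
Definition dhypot g f : R := f / hypot g f.

Lemma norm_dhypot_le1 g f : `|dhypot g f| <= 1.
Proof.
rewrite normrM normfV (ger0_norm (hypot_ge0 g f)).
have [->|b0] := eqVneq (hypot g f) 0; first by rewrite invr0 mulr0.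
by rewrite ler_pdivrMr ?mul1r ?norm_le_hypot// lt_neqAle eq_sym b0 hypot_ge0.
Qed.

Definition bregman g f y : R := hypot g y - hypot g f - dhypot g f * (y - f).

(* With [u = (g, y)] and [v = (g, f)], [|v| * bregman g f y = |u||v| - u.v] and
   [(|u||v|)^2 - (u.v)^2 = g^2 (y - f)^2] (Lagrange's identity). *)
Lemma bregman_bound g f y : 0 <= bregman g f y /\
  g ^+ 2 * (y - f) ^+ 2 <= 2 * hypot g y * hypot g f ^+ 2 * bregman g f y.
Proof.
rewrite /bregman /dhypot; have := hypot_sqr g y; have := hypot_sqr g f.
have := hypot_ge0 g y; have := hypot_ge0 g f.
set a := hypot g y; set b := hypot g f => b0 a0 Eb Ea.
have [b00|bN0] := eqVneq b 0.
  have g0 : g ^+ 2 = 0.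
    by move: Eb; rewrite b00; have := sqr_ge0 g; have := sqr_ge0 f; lra.
  by rewrite b00 g0 invr0 mulr0 !mul0r !subr0 expr0n mulr0 mul0r; split.
have {}b0 : 0 < b by rewrite lt_neqAle eq_sym bN0.
set B := a - b - _; pose p := g ^+ 2 + f * y.
have BE : b * B = a * b - p.
  transitivity (a * b - b ^+ 2 - f * (y - f)); first by rewrite /B; field.
  by rewrite Eb /p; ring.
have pE : (a * b) ^+ 2 - p ^+ 2 = g ^+ 2 * (y - f) ^+ 2.
  by rewrite exprMn Ea Eb /p; ring.
have ab0 : 0 <= a * b by rewrite mulr_ge0// ltW.
have pab : p <= a * b.
  rewrite (le_trans (ler_norm p))// -(ger0_norm ab0) -ler_sqr ?nnegrE//.
  rewrite !real_normK ?num_real// -subr_ge0 pE.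
  by rewrite mulr_ge0 ?sqr_ge0.
have bB : 0 <= b * B by rewrite BE subr_ge0.
split; first by rewrite -(pmulr_rge0 _ b0).
rewrite -pE; have -> : 2 * a * b ^+ 2 * B = 2 * (a * b) * (b * B) by ring.
(* Factor [(a * b) ^+ 2 - p ^+ 2] and bound the factor [a * b + p] by [2 * (a * b)]. *)
by rewrite BE; nra.
Qed.

(** Threshold argument for the minimum [m]: with [a = hypot g y] and [b = hypot g f], either
    [m <= eta * (a + b)], or [a] and [b] are at most [m / eta]. In the latter case [bregman_bound]
    gives [m ^+ 4 <= 2 * a * b ^+ 2 * B <= 2 * (m / eta) ^+ 3 * B], and [m ^+ 3] cancels. *)
Lemma min_le_bregman eta g f y : 0 < eta ->
  Num.min `|g| `|y - f| <=
    eta * (hypot g y + hypot g f) + 2 / eta ^+ 3 * bregman g f y.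
Proof.
move=> eta0; have [B0 key] := bregman_bound g f y.
have := hypot_ge0 g y; have := hypot_ge0 g f.
move: key B0; set a := hypot g y; set b := hypot g f; set B := bregman _ _ _.
move=> key B0 b0 a0; set m := Num.min _ _.
have m0 : 0 <= m by rewrite le_min !normr_ge0.
have mg : m <= `|g| by rewrite ge_min lexx.
have mh : m <= `|y - f| by rewrite ge_min lexx orbT.
have e3 : 0 < eta ^+ 3 by rewrite exprn_gt0.
have CB0 : 0 <= 2 / eta ^+ 3 * B by rewrite !mulr_ge0// invr_ge0 ltW.
have [mab|mab] := leP m (eta * (a + b)).
  by rewrite (le_trans mab)// lerDl.
have {}m0 : 0 < m.
  by apply: le_lt_trans mab; rewrite mulr_ge0 ?addr_ge0// ltW.
have am : eta * a <= m by nra.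
have bm : eta * b <= m by nra.
have m4 : m ^+ 4 <= g ^+ 2 * (y - f) ^+ 2.
  rewrite -(real_normK (num_real g)) -(real_normK (num_real (y - f))).
  rewrite (_ : m ^+ 4 = m ^+ 2 * m ^+ 2); last by ring.
  by rewrite ler_pM ?sqr_ge0// ler_sqr ?nnegrE// ltW.
have abm : eta ^+ 3 * (a * b ^+ 2) <= m ^+ 3.
  rewrite (_ : eta ^+ 3 * _ = (eta * a) * (eta * b) ^+ 2); last by ring.
  rewrite (_ : m ^+ 3 = m * m ^+ 2); last by ring.
  rewrite ler_pM ?sqr_ge0 ?mulr_ge0 ?(ltW eta0)//.
  by rewrite ler_sqr ?nnegrE ?mulr_ge0 ?(ltW eta0)// ltW.
have le3 : eta ^+ 3 * m <= 2 * B.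
  rewrite -(ler_pM2l (exprn_gt0 3 m0)).
  rewrite (_ : m ^+ 3 * (eta ^+ 3 * m) = eta ^+ 3 * m ^+ 4); last by ring.
  apply: le_trans (_ : eta ^+ 3 * (2 * a * b ^+ 2 * B) <= _).
    by rewrite ler_pM2l// (le_trans m4).
  rewrite (_ : _ * _ = eta ^+ 3 * (a * b ^+ 2) * (2 * B)); last by ring.
  by rewrite ler_wpM2r// mulr_ge0.
apply: le_trans (_ : 2 / eta ^+ 3 * B <= _).
  by rewrite mulrAC ler_pdivlMr// mulrC.
by rewrite lerDr mulr_ge0 ?addr_ge0// ltW.
Qed.

(** The left side is the distance between [|a|] and [|b|]: the reverse triangle inequality, written
    so that the loss is twice the overlap. *)
Lemma norm_sub_min (a b : R) : `|a| + `|b| - 2 * Num.min `|a| `|b| <= `|a + b|.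
Proof.
have := ler_normB (a + b) b; have := ler_normB (a + b) a.
rewrite addrK (addrC a b) addrK (addrC b a).
by case: (leP `|a| `|b|) => ? ? ?; lra.
Qed.

(** As [lam <= 1], the triangle inequality through [f] bounds the overlap of [g] with
    [lam * (y - z)] by its overlaps with [y - f] and [z - f]. The factor 2 of [norm_sub_min] doubles
    the constants of [min_le_bregman]. *)
Lemma hypot_perturbation eta g f y z lam : 0 < eta -> 0 <= lam <= 1 ->
  `|g| + lam * `|y - z| <= `|g + lam * (y - z)| +
    2 * eta * (hypot g y + hypot g z + 2 * hypot g f) +
    4 / eta ^+ 3 * (bregman g f y + bregman g f z).
Proof.
move=> eta0 /andP[l0 l1].
have := norm_sub_min g (lam * (y - z)); rewrite normrM (ger0_norm l0).
have := min_le_bregman g f y eta0; have := min_le_bregman g f z eta0.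
have : Num.min `|g| (lam * `|y - z|) <=
    Num.min `|g| `|y - f| + Num.min `|g| `|z - f|.
  have yz : lam * `|y - z| <= `|y - f| + `|z - f|.
    have := ler_normB (y - f) (z - f); rewrite opprB addrA subrK.
    have := normr_ge0 (y - z); nra.
  have := normr_ge0 g; have := normr_ge0 (y - f); have := normr_ge0 (z - f).
  move: yz; move: `|g| `|y - f| `|z - f| (lam * `|y - z|) => p q r s.
  by case: (leP p s); case: (leP p q); case: (leP p r); lra.
rewrite (_ : 4 / eta ^+ 3 = 2 * (2 / eta ^+ 3)); last by rewrite mulrA -natrM.
move: (2 / eta ^+ 3) (Num.min _ _) (Num.min _ _) (Num.min _ _) => K m1 m2 m3.
nra.
Qed.

(** [M] will bound Phi, which enters four times ([y], [z] and twice [f]); [4 * e] will bound the two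
    divergences together. Since [4 / eta ^+ 3] is large, [eta] is fixed before [e]. *)
Lemma perturbation_constants (M eps : R) : 0 < M -> 0 < eps ->
  exists eta e, [/\ 0 < eta, 0 < e, 2 * eta * (4 * M) <= eps / 4 &
    4 / eta ^+ 3 * (4 * e) <= eps / 4].
Proof.
move=> M0 eps0; pose eta := eps / (32 * M).
have eta0 : 0 < eta by rewrite divr_gt0// mulr_gt0.
have eta3 : 0 < eta ^+ 3 by rewrite exprn_gt0.
have M_neq0 : M != 0 by rewrite gt_eqF.
have eta_neq0 : eta != 0 by rewrite gt_eqF.
exists eta, (eps * eta ^+ 3 / 64); split => //.
- by rewrite divr_gt0// mulr_gt0.
- by rewrite /eta le_eqVlt; apply/orP; left; apply/eqP; field.
- by rewrite le_eqVlt; apply/orP; left; apply/eqP; field.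
Qed.

End Hypot.

(** * Integration on representatives of elements of L1 *)

Section L1.
Context {R : realType} {d : measure_display} {T : measurableType d}.
Context {mu : {measure set T -> \bar R}}.
Local Notation L1 := (LspaceType1 mu).
Implicit Types f g x y z : L1.

Definition real_integrable (h : T -> R) := mu.-integrable setT (EFin \o h).

Lemma L1_integrable x : real_integrable x.
Proof. exact/Lfun1_integrable/Lspace_Lfun. Qed.

Lemma L1_measurable x : measurable_fun setT (x : T -> R).
Proof. exact/measurable_EFinP/(measurable_int mu)/L1_integrable. Qed.

Lemma real_integrable_le (h k : T -> R) : measurable_fun setT h ->
  (forall t, `|h t| <= `|k t|) -> real_integrable k -> real_integrable h.
Proof.
move=> mh hk; apply: le_integrable => //; first exact/measurable_EFinP.
by move=> t _; rewrite !abse_EFin lee_fin.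
Qed.

Lemma real_integrableD (h k : T -> R) : real_integrable h ->
  real_integrable k -> real_integrable (fun t => h t + k t).
Proof. exact: integrableD. Qed.

Lemma real_integrableB (h k : T -> R) : real_integrable h ->
  real_integrable k -> real_integrable (fun t => h t - k t).
Proof. exact: integrableB. Qed.

Lemma real_integrableZ a (h : T -> R) : real_integrable h ->
  real_integrable (fun t => a * h t).
Proof. exact: integrableZl. Qed.

Lemma real_integrable_norm (h : T -> R) : real_integrable h ->
  real_integrable (fun t => `|h t|).
Proof. exact: integrable_norm. Qed.

Lemma ae_eq_Rintegral (h k : T -> R) :
  measurable_fun setT h -> measurable_fun setT k ->
  h = k %[ae mu] -> \int[mu]_t h t = \int[mu]_t k t.
Proof.
move=> mh mk hk; congr fine; apply: ae_eq_integral => //;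
  [exact/measurable_EFinP|exact/measurable_EFinP|].
by apply: filterS hk => t /(_ I) /= ->.
Qed.

Lemma L1_addE x y : (x + y : L1) = (fun t => x t + y t) %[ae mu].
Proof. exact: Lspace_addE. Qed.

Lemma L1_scaleE a x : (a *: x : L1) = (fun t => a * x t) %[ae mu].
Proof. exact: Lspace_scaleE. Qed.

Lemma L1_lincombE a x y : (a *: x + y : L1) = (fun t => a * x t + y t) %[ae mu].
Proof.
apply: filterS2 (L1_addE (a *: x) y) (L1_scaleE a x) => t /(_ I) -> /(_ I) E _.
by rewrite E.
Qed.

Lemma L1_subE x y : (x - y : L1) = (fun t => x t - y t) %[ae mu].
Proof.
have := L1_lincombE (- 1) y x; rewrite scaleN1r addrC.
by apply: filterS => t /(_ I) -> _; rewrite mulN1r addrC.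
Qed.

Lemma L1_normE x : `|x| = \int[mu]_t `|x t|.
Proof. exact: LspaceType1_normE. Qed.

Lemma L1_norm_ae x (h : T -> R) : measurable_fun setT h ->
  x = h %[ae mu] -> `|x| = \int[mu]_t `|h t|.
Proof.
move=> mh xh; rewrite L1_normE; apply: ae_eq_Rintegral.
- exact/measurableT_comp/L1_measurable.
- exact: measurableT_comp.
- by apply: filterS xh => t /(_ I) ->.
Qed.

(** * Functions bounded by 1 as continuous functionals on L1 *)

Section Multiplier.
Variables (theta : T -> R).
Hypotheses (mtheta : measurable_fun setT theta)
  (theta1 : forall t, `|theta t| <= 1).

Lemma mul_measurable x : measurable_fun setT (fun t => theta t * x t).
Proof. exact/measurable_funM/L1_measurable. Qed.

Lemma mul_integrable x : real_integrable (fun t => theta t * x t).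
Proof.
apply: real_integrable_le (L1_integrable x); first exact: mul_measurable.
by move=> t; rewrite normrM ler_piMl.
Qed.

(** The codomain [R^o] is the real line as a normed module over itself, so that continuity follows
    from boundedness of a linear map. *)
Definition pairing x : R^o := \int[mu]_t (theta t * x t).

Lemma pairing_linear : linear pairing.
Proof.
move=> a x y; rewrite /pairing.
transitivity (\int[mu]_t (a * (theta t * x t) + theta t * y t)).
  apply: ae_eq_Rintegral; first exact: mul_measurable.
    apply: measurable_funD; last exact: mul_measurable.
    by apply: measurable_funM => //; exact: mul_measurable.
  by apply: filterS (L1_lincombE a x y) => t /(_ I) -> _ /=; ring.
rewrite RintegralD//; [|exact/real_integrableZ/mul_integrable|
  exact: mul_integrable].
by rewrite RintegralZl//; exact: mul_integrable.
Qed.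

HB.instance Definition _ :=
  GRing.isLinear.Build R L1 R^o *:%R pairing pairing_linear.

Lemma norm_pairing_le x : `|pairing x| <= `|x|.
Proof.
rewrite L1_normE (le_trans (le_normr_Rintegral _ (mul_integrable x)))//.
apply: le_Rintegral => //.
- exact: real_integrable_norm (mul_integrable x).
- exact: real_integrable_norm (L1_integrable x).
- by move=> t _; rewrite normrM ler_piMl.
Qed.

Lemma pairing_continuous : continuous (pairing : L1 -> R).
Proof.
apply: (@bounded_linear_continuous R L1 R^o pairing).
apply/bounded_funP => r; exists r => x xr.
exact: le_trans (norm_pairing_le x) xr.
Qed.

Definition pairing_dual : continuous_dual L1 :=
  exist _ (pairing : {scalar L1}) pairing_continuous.

End Multiplier.

(** * The convex functional Phi, its derivative and the integrated estimate *)

Definition hypot_int g f : R := \int[mu]_t hypot (g t) (f t).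

Lemma measurable_hypot (h k : T -> R) : measurable_fun setT h ->
  measurable_fun setT k -> measurable_fun setT (fun t => hypot (h t) (k t)).
Proof.
move=> mh mk; apply: measurableT_comp.
  by apply: continuous_measurable_fun; exact: realfun.sqrt_continuous.
by apply: measurable_funD; exact: measurable_funX.
Qed.

Lemma measurable_dhypot g f : measurable_fun setT (fun t => dhypot (g t) (f t)).
Proof.
have mh := measurable_hypot (L1_measurable g) (L1_measurable f).
(* Inverse and power [-1] agree on nonnegative reals, including at 0, and real powers are
   measurable. *)
rewrite (_ : (fun t => _) = (fun t => f t * hypot (g t) (f t) `^ (- 1))).
  apply: measurable_funM; first exact: L1_measurable.
  exact: (measurableT_comp (measurable_powR (- 1))).
by apply/funext => t; rewrite powR_inv1 ?hypot_ge0.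
Qed.

Lemma hypot_integrable g f : real_integrable (fun t => hypot (g t) (f t)).
Proof.
apply: (@real_integrable_le _ (fun t => `|g t| + `|f t|)).
- by apply: measurable_hypot; exact: L1_measurable.
- move=> t; rewrite (ger0_norm (hypot_ge0 _ _)).
  exact: le_trans (hypot_le_normD _ _) (ler_norm _).
- by apply: real_integrableD; apply/real_integrable_norm/L1_integrable.
Qed.

Lemma hypot_int_le g f : hypot_int g f <= `|g| + `|f|.
Proof.
have ig := real_integrable_norm (L1_integrable g).
have if_ := real_integrable_norm (L1_integrable f).
rewrite !L1_normE -RintegralD//; apply: le_Rintegral => //.
- exact: hypot_integrable.
- exact: real_integrableD.
- by move=> t _; exact: hypot_le_normD.
Qed.

(** A subgradient of Phi at [f]; its bounded density puts it in the dual, so it is nearly constant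
    on a weak neighbourhood of [f]. *)
Definition grad g f : continuous_dual L1 :=
  pairing_dual (measurable_dhypot g f) (fun t => norm_dhypot_le1 (g t) (f t)).

Lemma bregman_int g f y :
  let B t := bregman (g t) (f t) (y t) in real_integrable B /\
  \int[mu]_t B t = hypot_int g y - hypot_int g f
    - (sval (grad g f) y - sval (grad g f) f).
Proof.
have hi := hypot_integrable g.
have pi := mul_integrable (measurable_dhypot g f)
  (fun t => norm_dhypot_le1 (g t) (f t)).
have Hi := real_integrableB (hi y) (hi f).
have Pi := real_integrableB (pi y) (pi f).
have BE : (fun t => bregman (g t) (f t) (y t)) = (fun t =>
    (hypot (g t) (y t) - hypot (g t) (f t)) -
    (dhypot (g t) (f t) * y t - dhypot (g t) (f t) * f t)).
  by apply/funext => t; rewrite /bregman mulrBr.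
rewrite /= BE; split; first exact: real_integrableB.
rewrite (RintegralB measurableT Hi Pi) (RintegralB measurableT (hi y) (hi f)).
by rewrite (RintegralB measurableT (pi y) (pi f)).
Qed.

(** [hypot_perturbation] integrated. Expanding the divergences by [bregman_int] leaves only values
    of Phi and of [grad g f], which are controlled by the choice of [f] and of a weak
    neighbourhood. *)
Lemma L1_perturbation eta g f y z lam : 0 < eta -> 0 <= lam <= 1 ->
  `|g| + lam * `|y - z| <= `|g + lam *: (y - z)| +
    2 * eta * (hypot_int g y + hypot_int g z + 2 * hypot_int g f) +
    4 / eta ^+ 3 * (hypot_int g y + hypot_int g z - 2 * hypot_int g f
      - (sval (grad g f) y - sval (grad g f) f)
      - (sval (grad g f) z - sval (grad g f) f)).
Proof.
move=> eta0 lam01; have [By BEy] := bregman_int g f y.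
have [Bz BEz] := bregman_int g f z.
have mg := L1_measurable g; have ig := L1_integrable g.
have iyz : real_integrable (fun t => y t - z t).
  by apply: real_integrableB; exact: L1_integrable.
have myz : measurable_fun setT (fun t => y t - z t).
  by apply: measurable_funB; exact: L1_measurable.
have ih := hypot_integrable g.
have ilam : real_integrable (fun t => g t + lam * (y t - z t)).
  exact/real_integrableD/real_integrableZ.
rewrite (L1_norm_ae myz (L1_subE y z)).
rewrite (@L1_norm_ae (g + lam *: (y - z)) (fun t => g t + lam * (y t - z t))).
- rewrite L1_normE -RintegralZl//; last exact: real_integrable_norm.
  rewrite -RintegralD//; last 2 first.
    exact: real_integrable_norm.
  exact/real_integrableZ/real_integrable_norm.
  set K := 4 / _; set rhs := (X in _ <= X).
  have isum := real_integrableD (real_integrableD (ih y) (ih z))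
    (real_integrableZ 2 (ih f)).
  (* Gather the right side into one integral, so that the pointwise bound applies. *)
  have -> : rhs = \int[mu]_t (`|g t + lam * (y t - z t)| +
    2 * eta * (hypot (g t) (y t) + hypot (g t) (z t) + 2 * hypot (g t) (f t)) +
    K * (bregman (g t) (f t) (y t) + bregman (g t) (f t) (z t))).
    have i1 := real_integrable_norm ilam.
    have i2 := real_integrableZ (2 * eta) isum.
    have i3 := real_integrableZ K (real_integrableD By Bz).
    have i12 := real_integrableD i1 i2.
    rewrite (RintegralD measurableT i12 i3) (RintegralD measurableT i1 i2).
    rewrite (RintegralZl _ measurableT isum).
    rewrite (RintegralZl _ measurableT (real_integrableD By Bz)).
    rewrite (RintegralD measurableT By Bz) BEy BEz.
    rewrite (RintegralD measurableT (real_integrableD (ih y) (ih z))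
      (real_integrableZ 2 (ih f))).
    rewrite (RintegralD measurableT (ih y) (ih z)).
    rewrite (RintegralZl _ measurableT (ih f)).
    by rewrite /rhs /hypot_int; ring.
  apply: le_Rintegral => //.
  + apply: real_integrableD; first exact: real_integrable_norm.
    exact/real_integrableZ/real_integrable_norm.
  + apply: real_integrableD; last exact/real_integrableZ/real_integrableD.
    by apply: real_integrableD; [exact: real_integrable_norm|
      exact: real_integrableZ].
  + by move=> t _; exact: hypot_perturbation.
- exact/measurable_EFinP/(measurable_int mu)/ilam.
- apply: filterS2 (L1_lincombE lam (y - z) g) (L1_subE y z) => t.
  by rewrite addrC => /(_ I) -> /(_ I) -> _; rewrite addrC.
Qed.

End L1.

(** * Weak slabs, convex combinations of sets and diameters *)

Section OpenSubsets.
Context {R : realType} {X : normedModType R} {D : set X} (tau : Topological D).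
Implicit Types C W : set X.

(** The weak topology refines the initial topology of each single [phi], in which the slab is the
    preimage of a ball. *)
Lemma open_weak_slab (phi : continuous_dual X) (c e : R) :
  0 < e -> open [set x : weak_topology X | `|sval phi x - c| < e].
Proof.
move=> e0; rewrite openE => x Ax.
have /cvg_sup/(_ phi) : nbhs x --> (x : weak_topology X) by [].
move=> H; apply: H; apply: open_nbhs_nbhs; split=> //.
exists (ball c e); first exact: ball_open.
by apply/seteqP; split=> y /=; rewrite -ball_normE/= distrC.
Qed.

Lemma nonempty_open_in_slab C W f e (phi : continuous_dual X) :
  contains_relative_weak tau -> nonempty_open_in tau C W -> W f -> 0 < e ->
  nonempty_open_in tau C (W `&` [set y | `|sval phi y - sval phi f| < e]).
Proof.
move=> weak [_ [V oV ->]] Wf e0; split.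
  by exists f; split => //=; rewrite subrr normr0.
set S := [set y | _]; exists (V `&` [set x : D | S (\val x)]).
  by apply: openI => //; exact/weak/open_weak_slab.
apply/seteqP; split => [x [[[v Vv <-] Cx] Sx]|x [[v [Vv Sv] <-] Cx]].
  by split=> //; exists v.
by split => //; split => //; exists v.
Qed.

Lemma nonempty_open_in_sub C W : nonempty_open_in tau C W -> W `<=` C.
Proof. by move=> [_ [V _ ->]] x []. Qed.

Lemma nonempty_open_in_self : D !=set0 -> nonempty_open_in tau D D.
Proof.
move=> D0; split=> //; exists setT; first exact: openT.
apply/seteqP; split => [x Dx|x []//]; split => //.
by exists (exist _ x (mem_set Dx)).
Qed.

Lemma conv_combs1 (F : set_system X) W : F W -> conv_combs F W.
Proof.
move=> FW; exists 1%N, (fun=> 1), (fun=> W); split => //.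
  by rewrite big_ord1.
apply/seteqP; split => [x Wx|_ [u Wu <-]].
  by exists (fun=> x) => //; rewrite big_ord1 scale1r.
by rewrite big_ord1 scale1r; exact: Wu.
Qed.

Lemma conv_comb_norm_le n (lambda : 'I_n -> R) (U : 'I_n -> set X) M w :
  (forall i, 0 <= lambda i) -> \sum_i lambda i = 1 ->
  (forall i x, U i x -> `|x| <= M) -> conv_comb lambda U w -> `|w| <= M.
Proof.
move=> l0 lsum UM [u Uu <-]; rewrite (le_trans (ler_norm_sum _ _ _))//.
rewrite -[leRHS]mul1r -lsum mulr_suml; apply: ler_sum => i _.
by rewrite normrZ ger0_norm// ler_wpM2l// (UM i).
Qed.

Lemma conv_comb_nonempty n (lambda : 'I_n -> R) (U : 'I_n -> set X) :
  (forall i, U i !=set0) -> conv_comb lambda U !=set0.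
Proof. by move=> /choice[u Uu]; exists (\sum_i lambda i *: u i), u. Qed.

(** The bound [M] supplies the upper bound [M + M] that makes [sup] a genuine supremum. *)
Lemma le_diam W x y M : (forall w, W w -> `|w| <= M) -> W x -> W y ->
  `|x - y| <= diam W.
Proof.
move=> WM Wx Wy; apply: ub_le_sup; last by exists x => //; exists y.
exists (M + M) => _ [u Wu [v Wv <-]].
by rewrite (le_trans (ler_normB _ _))// lerD// WM.
Qed.

Lemma diam_le W c : W !=set0 ->
  (forall x y, W x -> W y -> `|x - y| <= c) -> diam W <= c.
Proof.
move=> [w Ww] h; apply: ge_sup; first by exists `|w - w|, w => //; exists w.
by move=> _ [u Wu [v Wv <-]]; exact: h.
Qed.

Lemma diam_gt W c : W !=set0 -> c < diam W ->
  exists x y, [/\ W x, W y & c < `|x - y|].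
Proof.
move=> [w Ww] /sup_gt [|_ [x Wx [y Wy <-]] cxy].
  by exists `|w - w|, w => //; exists w.
by exists x, y.
Qed.

End OpenSubsets.

(** * Lower diameter bounds pass to convex combinations of open sets *)

Section ConvexCombinations.
Context {R : realType} {d : measure_display} {T : measurableType d}.
Context {mu : {measure set T -> \bar R}}.
Local Notation L1 := (LspaceType1 mu).
Context {D : set L1} (tau : Topological D) (C : set L1) (delta : R).
Hypotheses (weak : contains_relative_weak tau)
  (C1 : forall x, C x -> `|x| <= 1)
  (Cdelta : forall W, nonempty_open_in tau C W -> delta <= diam W).

(** One step of the iteration, [g] being the partial sum already built. Of the loss [eps], half
    comes from the distance of [y] and [z], a quarter from each error term of [L1_perturbation]. *)
Lemma almost_disjoint_pair (g : L1) U lam eps : nonempty_open_in tau C U ->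
  0 <= lam <= 1 -> 0 < eps ->
  exists y z, [/\ U y, U z & `|g| + lam * delta - eps <= `|g + lam *: (y - z)|].
Proof.
move=> oU lam01 eps0; have UC := nonempty_open_in_sub oU.
have ng0 := normr_ge0 g.
have gU x : U x -> hypot_int g x <= `|g| + 1.
  by move=> /UC/C1 x1; rewrite (le_trans (hypot_int_le _ _))// lerD2l.
have g1 : 0 < `|g| + 1 by rewrite ltr_wpDl.
have [eta [e [eta0 e0 eta_le e_le]]] := perturbation_constants g1 eps0.
pose K := 4 / eta ^+ 3; have K0 : 0 < K by rewrite divr_gt0// exprn_gt0.
have [u0 Uu0] := oU.1.
have supU : has_sup [set hypot_int g x | x in U].
  split; first by exists (hypot_int g u0), u0.
  by exists (`|g| + 1) => _ [x Ux <-]; exact: gU.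
(* [f] maximizes Phi over [U] up to [e]; Phi is at most [|g| + 1] there because [C] lies in the unit
   ball. *)
have [_ [f Uf <-] fsup] := sup_adherent e0 supU.
have fmax x : U x -> hypot_int g x < hypot_int g f + e.
  move=> Ux; rewrite -ltrBlDr; apply: le_lt_trans fsup; rewrite lerD2r.
  by apply: ub_le_sup; [exact: supU.2|exists x].
have oW := nonempty_open_in_slab (grad g f) weak oU Uf e0.
have [|y [z [[Uy /= ye] [Uz /= ze] yz]]] := @diam_gt _ _ _ (delta - eps / 2) oW.1.
  by rewrite (lt_le_trans _ (Cdelta oW))// ltrBlDr ltrDl divr_gt0.
exists y, z; split => //.
have := L1_perturbation g f y z eta0 lam01; rewrite -/K.
have : lam * (delta - eps / 2) <= lam * `|y - z|.
  by case/andP: lam01 => ? _; rewrite ler_wpM2l// ltW.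
have : 2 * eta * (hypot_int g y + hypot_int g z + 2 * hypot_int g f) <= eps / 4.
  apply: le_trans eta_le; rewrite ler_wpM2l ?mulr_ge0 ?(ltW eta0)//.
  by have := gU _ Uy; have := gU _ Uz; have := gU _ Uf; lra.
(* Each of [y] and [z] contributes at most [e] by near-maximality of [f] and at most [e] by the
   slab, hence [4 * e]. *)
have : K * (hypot_int g y + hypot_int g z - 2 * hypot_int g f
    - (sval (grad g f) y - sval (grad g f) f)
    - (sval (grad g f) z - sval (grad g f) f)) <= eps / 4.
  apply: le_trans e_le; rewrite ler_pM2l//.
  have := fmax _ Uy; have := fmax _ Uz.
  by move: ye ze; rewrite !ltr_norml => /andP[? _] /andP[? _]; lra.
have lam2 : lam * (eps / 2) <= eps / 2.
  by case/andP: lam01 => ? ?; rewrite ler_piMl// ltW// divr_gt0.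
rewrite mulrBr; move: (K * _) (2 * eta * _) => A B; lra.
Qed.

(** Induction on [n], each set costing [eps]. The total weight stays explicit because removing the
    last set changes it. *)
Lemma conv_comb_differences n (lambda : 'I_n -> R) (U : 'I_n -> set L1) eps :
  (forall i, 0 <= lambda i <= 1) -> (forall i, nonempty_open_in tau C (U i)) ->
  0 < eps -> exists y z : 'I_n -> L1, [/\ forall i, U i (y i),
    forall i, U i (z i) &
    (\sum_i lambda i) * delta - n%:R * eps <=
      `|\sum_i lambda i *: (y i - z i)|].
Proof.
move=> + + eps0; elim: n lambda U => [|n IHn] lambda U l01 oU.
  exists (fun=> 0), (fun=> 0); split; [by case|by case|].
  by rewrite !big_ord0 !mul0r subr0 normr0.
pose w := widen_ord (leqnSn n).
have [y [z [Uy Uz yz]]] := IHn _ _ (fun i => l01 (w i)) (fun i => oU (w i)).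
have [y' [z' [Uy' Uz' yz']]] := almost_disjoint_pair
  (\sum_i lambda (w i) *: (y i - z i)) (oU ord_max) (l01 ord_max) eps0.
(* [ext] appends the last point to a family over ['I_n]; [w i] and [lift ord_max i] are the same
   ordinal. *)
pose ext (u : 'I_n -> L1) u' i := if unlift ord_max i is Some j then u j else u'.
have extw u u' i : ext u u' (w i) = u i.
  rewrite /ext (_ : w i = lift ord_max i) ?liftK//.
  by apply: ord_inj; rewrite lift_max.
have extm u u' : ext u u' ord_max = u' by rewrite /ext unlift_none.
have Uext u u' : (forall i, U (w i) (u i)) -> U ord_max u' ->
    forall i, U i (ext u u' i).
  move=> Uu Uu' i; have [j ->|->] := unliftP ord_max i; last by rewrite extm.
  rewrite (_ : lift _ _ = w j) ?extw//.
  by apply: ord_inj; rewrite lift_max.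
exists (ext y y'), (ext z z'); split; [exact: Uext|exact: Uext|].
rewrite !big_ord_recr/= !extm.
under [X in _ <= `|X + _|]eq_bigr do rewrite -/w !extw.
apply: le_trans yz'; rewrite mulrDl -natr1 mulrDl mul1r.
by move: yz; rewrite -/w; lra.
Qed.

(** The combinations of the [y i] and of the [z i] both lie in [W], and their difference is the sum
    just estimated. *)
Lemma le_diam_conv_combs W : conv_combs (nonempty_open_in tau C) W ->
  delta <= diam W.
Proof.
move=> [n [lambda [U [l0 lsum oU ->]]]].
have l01 i : 0 <= lambda i <= 1.
  by rewrite l0/= -lsum (bigD1 i)//= lerDl sumr_ge0.
have bnd w : conv_comb lambda U w -> `|w| <= 1.
  by apply: conv_comb_norm_le => // i x /(nonempty_open_in_sub (oU i))/C1.
apply/ler_addgt0Pr => e e0.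
(* Loss [e / n.+1] per set: [n] sets lose at most [e], and the denominator is positive for every
   [n]. *)
have [y [z [Uy Uz yz]]] := conv_comb_differences l01 oU
  (divr_gt0 e0 (ltr0Sn R n)).
have Wy : conv_comb lambda U (\sum_i lambda i *: y i) by exists y.
have Wz : conv_comb lambda U (\sum_i lambda i *: z i) by exists z.
rewrite -lerBlDr; apply: le_trans (le_diam bnd Wy Wz).
rewrite -sumrB; under eq_bigr do rewrite -scalerBr.
apply: le_trans yz; rewrite lsum mul1r lerD2l lerN2.
by rewrite mulrCA ger_pMr// ler_pdivrMr ?ltr0Sn// mul1r ler_nat.
Qed.

End ConvexCombinations.

(** * Diameter two, point of continuity and strong regularity of [D] *)

Theorem corollary1p4 (R : realType) (d : measure_display) (T : measurableType d)
    (mu : {measure set T -> \bar R}) (D : set (LspaceType1 mu))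
    (tau : Topological D) :
  D !=set0 -> convex_set D ->
  D `<=` closed_ball_ Num.norm (0 : LspaceType1 mu) 1 ->
  contains_relative_weak tau ->
  [/\ diameter_two_property tau <-> strong_diameter_two_property tau,
      convex_point_of_continuity_property tau <-> strongly_regular tau &
      (exists2 delta : R, 0 < delta <= 2 &
         forall W, nonempty_open_in tau D W -> delta <= diam W) ->
      ~ strongly_regular_for_open_subsets tau].
Proof.
move=> D0 cD DB weak.
have D1 x : D x -> `|x| <= 1 by move=> /DB; rewrite /closed_ball_/= sub0r normrN.
split.
- split=> [D2 W cW|SD2 W oW]; last exact/SD2/conv_combs1.
  (* The lower bound is [le_diam_conv_combs] with [delta = 2]; the upper one holds because [W] stays
     in the unit ball. *)
  apply/eqP; rewrite eq_le; apply/andP; split; last first.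
    by apply: le_diam_conv_combs cW => // V /D2 ->.
  have [n [lambda [U [l0 lsum oU WE]]]] := cW.
  have W0 : W !=set0.
    by rewrite WE; apply: conv_comb_nonempty => i; have [] := oU i.
  have W1 w : W w -> `|w| <= 1.
    rewrite WE; apply: conv_comb_norm_le => // i x.
    by move/(nonempty_open_in_sub (oU i))/D1.
  apply: diam_le => // x y Wx Wy.
  by rewrite (le_trans (ler_normB _ _))// -[leRHS]/(1 + 1) lerD ?W1.
- split=> [CPCP C CD C0 bC cC e e0|SR C CD C0 bC cC e e0].
    by have [W oW We] := CPCP C CD C0 bC cC e e0; exists W => //; exact: conv_combs1.
  (* Otherwise every nonempty open subset of [C] has diameter at least [e], hence so does [W]. *)
  apply: contrapT => noW; have [W cW We] := SR C CD C0 bC cC e e0.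
  have : e <= diam W.
    apply: le_diam_conv_combs cW => // [x /CD/D1//|V oV].
    by rewrite leNgt; apply/negP => Ve; apply: noW; exists V.
  by rewrite leNgt We.
- move=> [delta /andP[delta0 _] Ddelta] SR.
  (* Regularity is tested on the open convex set [D] itself, with [e = delta]. *)
  have [W cW Wd] := SR D (nonempty_open_in_self tau D0) cD delta delta0.
  have : delta <= diam W by exact: le_diam_conv_combs cW.
  by rewrite leNgt Wd.
Qed.
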